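(* Let $m\geq n\geq 1$ be integers and set $\alpha=\frac{n}{m}$. Let $D\subset\mathbb{R}^n$ be an arbitrary set and $f:D\rightarrow\mathbb{R}^m$ an arbitrary function. Then for almost every $x\in D$ there is a sequence $(x_k)\subset D\setminus\{x\}$ converging to $x$ with $$ \limsup_{k\rightarrow\infty} \frac{|f(x)-f(x_k)|}{|x-x_k|^\alpha} < \infty . $$
   Context: $|\cdot|$ is the Euclidean norm. ''Measure'' means Lebesgue outer measure throughout; neither $D$ nor $f$ is assumed measurable. ''For almost every $x\in D$'' means: for all $x\in D$ outside a subset of $n$-dimensional Lebesgue outer measure zero. *)

(* Defs.v *)
From HB Require Import structures.
From mathcomp Require Import all_boot all_order all_algebra.
From mathcomp Require Import all_classical all_reals all_analysis.

Set Implicit Arguments.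
Unset Strict Implicit.
Unset Printing Implicit Defensive.

Import Order.TTheory GRing.Theory Num.Theory.
Import numFieldNormedType.Exports.

Local Open Scope classical_set_scope.
Local Open Scope ring_scope.

(* The library norm on row vectors is the sup norm, hence a separate name. *)
Definition enorm (R : realType) (n : nat) (x : 'rV[R]_n) : R :=
  Num.sqrt (\sum_(i < n) x ord0 i ^+ 2).

Definition box (R : realType) (n : nat) (a b : 'rV[R]_n) : set 'rV[R]_n :=
  [set x | forall i, a ord0 i <= x ord0 i <= b ord0 i].

(* Meaningful only when a <= b componentwise; see box_cover. *)
Definition box_volume (R : realType) (n : nat) (a b : 'rV[R]_n) : R :=
  \prod_(i < n) (b ord0 i - a ord0 i).

(* The k-th box is [F k .1, F k .2]. Degenerate boxes are allowed, so for
   1 <= n finite covers are included. *)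
Definition box_cover (R : realType) (n : nat) (A : set 'rV[R]_n)
    (F : nat -> 'rV[R]_n * 'rV[R]_n) : Prop :=
  (forall k i, (F k).1 ord0 i <= (F k).2 ord0 i) /\
  A `<=` \bigcup_k box (F k).1 (F k).2.

(* n-dimensional Lebesgue outer measure, for 1 <= n. *)
Definition lebesgue_outer (R : realType) (n : nat) (A : set 'rV[R]_n) : \bar R :=
  ereal_inf [set (\sum_(0 <= k <oo) (box_volume (F k).1 (F k).2)%:E)%E
            | F in box_cover A].

(* Main.v *)
(* Call x exceptional when, for every C, all points y <> x of D close enough to
   x satisfy C |x - y|^n < |f x - f y|^m; at any other point the required
   sequence exists by definition. The exceptional set is a countable union of
   pieces on which f takes values in a single unit cube and
   |x - y|^n < |f x - f y|^m holds for all pairs of distinct points. Fix such a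
   piece and C > 0. A dyadic cube Q of side s meeting the image of the piece is
   called good if the part of the piece mapped to Q lies in a cube of volume
   2^n s^m / C. Every sufficiently small Q containing f x is good: the
   inequality with constant 1 makes the preimage of Q so small that the
   inequality with constant C applies around x. Maximal good cubes are disjoint
   subcubes of the unit cube, so their volumes add up to at most 1, and the
   piece has outer measure at most 2^n / C. Only the center x has to satisfy the
   inequality with constant C at the scale of Q, so no continuity of the outer
   measure along increasing unions of nonmeasurable sets is needed. *)
Require Import Defs.
From HB Require Import structures.
From mathcomp Require Import all_boot all_order all_algebra.
From mathcomp Require Import all_classical all_reals all_analysis.
From mathcomp Require Import ring lra.

Import Order.TTheory GRing.Theory Num.Theory.
Import numFieldNormedType.Exports.

Local Open Scope classical_set_scope.
Local Open Scope ring_scope.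

(** * Kraft's inequality for prefix codes *)

Lemma kraft_seq (R : realFieldType) (B : finType) (s : seq (seq B)) :
    uniq s ->
    (forall v w, v \in s -> w \in s -> prefix v w -> v = w) ->
  \sum_(w <- s) #|B|%:R ^- size w <= 1 :> R.
Proof.
have [L] : exists L, forall w, w \in s -> (size w < L)%N.
  by exists (\max_(w <- s) size w).+1 => w ws; exact: leq_bigmax_seq.
elim: L s => [|L IH] s sL us pf.
  by rewrite big_seq big1 // => w /sL.
(* The empty word is a prefix of every word, so a code containing it has no other word. *)
have [s0|s0] := boolP ([::] \in s).
  rewrite (perm_big [:: [::]]) ?big_seq1 ?expr0 ?invr1//=.
  apply: uniq_perm => // w; rewrite inE; apply/idP/eqP => [ws|-> //].
  by apply/esym/pf; rewrite ?prefix0s.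
case: s s0 sL us pf => [|[|b0 w0] s']; first by rewrite big_nil.
  by rewrite inE.
set s := _ :: s' => s0 sL us pf.
(* Split by first letter. Deleting that letter from the words of one class leaves a prefix code of
   shorter words, so by induction each class contributes at most [#|B|%:R^-1]. The default [b0] is
   never read, since no word is empty. *)
rewrite (partition_big (head b0) predT) //=.
apply: (@le_trans _ _ (\sum_(b : B) #|B|%:R^-1)); last first.
  rewrite sumr_const -[_ *+ _]mulr_natr.
  have [->|B0] := eqVneq (#|B|%:R : R) 0; first by rewrite mulr0.
  by rewrite mulVf.
apply: ler_sum => b _.
pose t := [seq behead w | w <- s & head b0 w == b].
have sE w : w \in s -> head b0 w == b -> w = b :: behead w.
  by case: w => [|c w]; [rewrite (negbTE s0) | move=> _ /= /eqP ->].
have tP w : w \in t -> b :: w \in s.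
  move=> /mapP[v]; rewrite mem_filter => /andP[vb vs] ->.
  by rewrite -sE.
rewrite (_ : \sum_(_ <- _ | _) _ =
    #|B|%:R^-1 * \sum_(w <- t) #|B|%:R ^- size w).
  rewrite ler_piMr ?invr_ge0 ?ler0n//; apply: IH.
  - by move=> w /tP /sL.
  - rewrite map_inj_in_uniq ?filter_uniq// => v w.
    rewrite !mem_filter => /andP[vb vs] /andP[wb ws] vw.
    by rewrite (sE v)// (sE w)// vw.
  - move=> v w /tP vs /tP ws vw.
    by have [] : b :: v = b :: w by apply: pf => //=; rewrite eqxx.
rewrite mulr_sumr big_map big_filter big_seq_cond [RHS]big_seq_cond.
apply: eq_bigr => w /andP[ws wb].
by rewrite [in LHS](sE w)//= exprS invfM.
Qed.

Lemma kraft_esum (R : realType) (B : finType) (W : set (seq B)) (c : R) :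
    0 <= c -> (forall v w, W v -> W w -> prefix v w -> v = w) ->
  (\esum_(w in W) (c * #|B|%:R ^- size w)%:E <= c%:E)%E.
Proof.
move=> c0 pf; apply: ge_ereal_sup => _ [X [finX XW] <-].
rewrite fsbig_finite//= sumEFin lee_fin -mulr_sumr ler_piMr//.
rewrite kraft_seq ?finmap.fset_uniq//.
by move=> v w; rewrite !in_fset_set// !inE => /XW Wv /XW Ww; apply: pf.
Qed.

(** * The sup norm in coordinates *)

Lemma rV_norm_le (R : realType) (k : nat) (x : 'rV[R]_k) (c : R) :
  0 <= c -> (forall i, `|x ord0 i| <= c) -> `|x| <= c.
Proof.
move=> c0 xc; rewrite [leLHS]/Num.norm/= mx_normrE.
apply/bigmax_leP; split=> //.
by move=> [i j] _ /=; rewrite ord1.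
Qed.

Lemma rV_coord_le (R : realType) (k : nat) (x : 'rV[R]_k) i :
  `|x ord0 i| <= `|x|.
Proof.
rewrite [leRHS]/Num.norm/= mx_normrE.
exact: (le_bigmax _ (fun ij : 'I_1 * 'I_k => `|x ij.1 ij.2|) (ord0, i)).
Qed.

(** * Outer measure: countable covers, null unions, coded covers *)

Section outer.
Context {R : realType} {n : nat}.
Hypothesis n_gt0 : (0 < n)%N.
Implicit Types A : set 'rV[R]_n.

Lemma box_volume_ge0 (a b : 'rV[R]_n) :
  (forall i, a ord0 i <= b ord0 i) -> 0 <= box_volume a b.
Proof. by move=> ab; apply: prodr_ge0 => i _; rewrite subr_ge0. Qed.

Lemma box_volume_id (a : 'rV[R]_n) : box_volume a a = 0.
Proof.
by rewrite /box_volume (bigD1 (Ordinal n_gt0))//= subrr mul0r.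
Qed.

Lemma lebesgue_outer_ge0 A : (0 <= lebesgue_outer A)%E.
Proof.
apply: le_ereal_inf_tmp => _ [F [Fle _] <-].
by apply: nneseries_ge0 => k _ _; rewrite lee_fin box_volume_ge0.
Qed.

(** Allows covers indexed by words or by pairs. Integers that code no index in [J] receive a
    one-point box, of volume 0 because [0 < n]. *)
Lemma lebesgue_outer_le_esum (I : countType) (J : set I)
    (a b : I -> 'rV[R]_n) A :
    (forall i j, J i -> a i ord0 j <= b i ord0 j) ->
    A `<=` \bigcup_(i in J) box (a i) (b i) ->
  (lebesgue_outer A <= \esum_(i in J) (box_volume (a i) (b i))%:E)%E.
Proof.
move=> ab AJ.
pose G i := if i \in J then (a i, b i) else (0, 0).
pose F k := oapp G (0, 0) (pickle_inv k).
have Gle i j : (G i).1 ord0 j <= (G i).2 ord0 j.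
  by rewrite /G; case: ifPn => //= /[!inE] /ab.
have Fle k j : (F k).1 ord0 j <= (F k).2 ord0 j.
  by rewrite /F; case: (pickle_inv k) => [i|] //=.
have Fpickle i : F (pickle i) = G i by rewrite /F pickleK_inv.
apply: (@le_trans _ _ (\sum_(0 <= k <oo) (box_volume (F k).1 (F k).2)%:E)%E).
  apply: ereal_inf_lbound; exists F => //; split => // x /AJ [i Ji xi].
  by exists (pickle i) => //; rewrite Fpickle /G mem_set.
rewrite nneseries_esumT; last by move=> k; rewrite lee_fin box_volume_ge0.
rewrite (_ : \esum_(k in _) _ =
    \esum_(k in pickle @` J) (box_volume (F k).1 (F k).2)%:E); last first.
  rewrite [RHS]esum_mkcond; apply: eq_esum => k _.
  case: ifPn => // /negP kJ; rewrite /F.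
  case: (pickle_inv k) (pickle_invK (T := I) k) => [i|] /= ik;
    last by rewrite box_volume_id.
  rewrite /G; case: ifPn => [/set_mem Ji|_]; last by rewrite box_volume_id.
  by case: kJ; apply/mem_set; exists i.
rewrite esum_image; last by move=> i j _ _; apply: (pcan_inj pickleK).
by apply: le_esum => i Ji; rewrite Fpickle /G mem_set.
Qed.

Lemma lebesgue_outer_bigcup0 (I : countType) (A : I -> set 'rV[R]_n) :
  (forall i, lebesgue_outer (A i) = 0%E) ->
  lebesgue_outer (\bigcup_i A i) = 0%E.
Proof.
move=> A0; apply/eqP; rewrite eq_le lebesgue_outer_ge0 andbT.
apply/lee_addgt0Pr => e e0; rewrite add0e.
pose d k : R := e / (2 ^ k.+1)%:R.
have d_gt0 k : 0 < d k by rewrite divr_gt0// ltr0n expn_gt0.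
have /choice[F FP] : forall i, exists F, box_cover (A i) F /\
    (\sum_(0 <= k <oo) (box_volume (F k).1 (F k).2)%:E <= (d (pickle i))%:E)%E.
  move=> i; have : (lebesgue_outer (A i) < (d (pickle i))%:E)%E.
    by rewrite A0 lte_fin.
  by move=> /ereal_inf_lt[_ [F FA <-] /ltW Fd]; exists F.
have Fle i k j : (F i k).1 ord0 j <= (F i k).2 ord0 j by have [[]] := FP i.
apply: le_trans (@lebesgue_outer_le_esum (I * nat)%type setT
  (fun p => (F p.1 p.2).1) (fun p => (F p.1 p.2).2) _ _ _) _ => //.
  move=> x [i _ Aix]; have [[_ /(_ _ Aix)[k _ xk]] _] := FP i.
  by exists (i, k).
rewrite (_ : [set: I * nat] = setT `*`` (fun=> setT)); last first.
  by apply/seteqP; split.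
rewrite -(esum_esum (a := fun i k =>
    (box_volume (F i k).1 (F i k).2)%:E)); last first.
  by move=> i k _ _; rewrite lee_fin box_volume_ge0.
apply: (@le_trans _ _ (\esum_(i in [set: I]) (d (pickle i))%:E)).
  apply: le_esum => i _; rewrite -nneseries_esumT; first by have [] := FP i.
  by move=> k; rewrite lee_fin box_volume_ge0.
rewrite -(esum_image _ pickle (fun k => (d k)%:E)); last first.
  by move=> i j _ _; apply: (pcan_inj pickleK).
apply: (@le_trans _ _ (\esum_(k in [set: nat]) (d k)%:E)).
  rewrite esum_mkcond; apply: le_esum => k _; case: ifPn => // _.
  by rewrite lee_fin ltW.
rewrite -nneseries_esumT; last by move=> k; rewrite lee_fin ltW.
exact: epsilon_trick0 (ltW e0).
Qed.

(* [code l x] is the address of the cell of depth l containing x, each cell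
   having #|B| children. The minimal good addresses form a prefix code. *)
Lemma lebesgue_outer_coded_le (B : finType) (T : Type) (X : T -> 'rV[R]_n)
    (code : nat -> T -> seq B) (A : set T) (C : R) :
    (forall l x, size (code l x) = l) ->
    (forall k l x, (k <= l)%N -> take k (code l x) = code k x) ->
    0 < C ->
    (forall x, A x -> exists l, forall y, A y -> code l y = code l x ->
       C * `|X x - X y| ^+ n <= #|B|%:R ^- l) ->
  (lebesgue_outer (X @` A) <= (2 ^+ n / C)%:E)%E.
Proof.
move=> code_size code_take C0 AC.
pose K : R := #|B|%:R.
have K0 l : 0 <= K ^- l by rewrite invr_ge0 exprn_ge0.
(* The center [p] may be any vector, so that goodness depends on the word alone. *)
pose good (w : seq B) := exists p : 'rV[R]_n,
  forall y, A y -> code (size w) y = w -> C * `|p - X y| ^+ n <= K ^- size w.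
pose W := [set w | good w /\ forall l, (l < size w)%N -> ~ good (take l w)].
have /choice[p pP] : forall w, exists p : 'rV[R]_n, good w ->
    forall y, A y -> code (size w) y = w -> C * `|p - X y| ^+ n <= K ^- size w.
  by move=> w; have [[p pw]|] := pselect (good w); [exists p|exists 0].
(* Half the side of the box for [w]: its volume is then [2 ^+ n / C] times the Kraft weight of
   [w]. *)
pose r (w : seq B) := (K ^- size w / C) `^ n%:R^-1.
have r0 w : 0 <= r w by exact: powR_ge0.
have rn w : r w ^+ n = K ^- size w / C.
  rewrite -powR_mulrn// -powRrM mulVf ?pnatr_eq0 -?lt0n// powRr1//.
  by rewrite divr_ge0// ltW.
have Aw x : A x -> exists l, W (code l x).
  move=> Ax; have [l xl] := AC x Ax.
  have ex : exists l, `[< good (code l x) >].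
    exists l; apply/asboolP; exists (X x); rewrite code_size; exact: xl.
  case: (ex_minnP ex) => k /asboolP gk kmin.
  exists k; split; first exact: gk.
  move=> j; rewrite (code_size k x) => jk; rewrite (code_take j k x (ltnW jk)).
  by move=> gj; move: jk; rewrite ltnNge kmin//; apply/asboolP.
apply: le_trans (@lebesgue_outer_le_esum (seq B) W
  (fun w => p w - const_mx (r w)) (fun w => p w + const_mx (r w)) _ _ _) _.
- by move=> w j _; rewrite !mxE lerD2l ge0_cp ?r0.
- move=> _ [x Ax <-]; have [l Wl] := Aw x Ax.
  exists (code l x) => // i; rewrite !mxE.
  suff : `|(p (code l x) - X x) ord0 i| <= r (code l x).
    by rewrite !mxE ler_distlC => /andP[-> ->].
  apply: le_trans (rV_coord_le _ _ _ _) _.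
  rewrite -(@ler_pXn2r _ n) ?nnegrE// rn ler_pdivlMr// mulrC.
  by apply: pP => //; [case: Wl|rewrite code_size].
- apply: le_trans (@kraft_esum R B W (2 ^+ n / C) _ _).
  + apply: le_esum => w _; rewrite lee_fin /box_volume.
    rewrite (eq_bigr (fun=> 2 * r w)); last first.
      by move=> i _; rewrite !mxE; ring.
    by rewrite prodr_const card_ord exprMn rn -mulrA [C^-1 * _]mulrC.
  + by rewrite divr_ge0 ?exprn_ge0// ltW.
  (* A proper prefix [v] of [w] would be a good truncation of [w], against minimality. *)
  + move=> v w [gv _] [_ wmin] vw.
    move: (vw) => /prefixP[s ws]; have := size_prefix vw.
    rewrite leq_eqVlt => /orP[/eqP vws|/wmin[]].
      move: vws; rewrite ws size_cat -[LHS]addn0 => /addnI/esym/size0nil ->.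
      by rewrite cats0.
    by rewrite ws take_size_cat.
Qed.

End outer.

(** * Dyadic addresses in the unit cube *)

Section bin.
Context {R : realType} {m : nat}.
Implicit Types y z : 'I_m -> R.

(** One letter collects the current binary digit of all [m] coordinates. The remainder map sends the
    closed interval [0, 1] to itself; at 1 every digit is one. *)
Fixpoint bin (l : nat) y : seq {ffun 'I_m -> bool} :=
  if l is l'.+1 then
    [ffun i => 2^-1 <= y i] :: bin l' (fun i => 2 * y i - (2^-1 <= y i)%R%:R)
  else [::].

Lemma size_bin l y : size (bin l y) = l.
Proof. by elim: l y => //= l IH y; rewrite IH. Qed.

Lemma take_bin k l y : (k <= l)%N -> take k (bin l y) = bin k y.
Proof.
elim: k l y => [|k IH] [|l] y; rewrite ?take0// => kl /=.
by rewrite IH.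
Qed.

Lemma bin_eq_dist l y z :
    (forall i, 0 <= y i <= 1) -> (forall i, 0 <= z i <= 1) ->
    bin l y = bin l z ->
  forall i, `|y i - z i| <= 2 ^- l.
Proof.
elim: l y z => [|l IH] y z y01 z01 /=.
  move=> _ i; rewrite expr0 invr1; have := y01 i; have := z01 i.
  by rewrite ler_norml; lra.
move=> [/ffunP yz] byz i.
have /= := IH _ _ _ _ byz i.
have h (x : 'I_m -> R) : (forall i, 0 <= x i <= 1) ->
    forall i, 0 <= 2 * x i - (2^-1 <= x i)%R%:R <= 1.
  by move=> x01 j; have := x01 j; case: (leP 2^-1 (x j)) => /=; lra.
move=> /(_ (h _ y01) (h _ z01)).
have := yz i; rewrite !ffunE => ->.
(* Equal digits cancel, so one step exactly doubles the distance. *)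
rewrite (_ : 2 * y i - _ - _ = 2 * (y i - z i)); last by ring.
rewrite normrM ger0_norm// exprS invfM => hh.
by rewrite -(@ler_pM2l _ 2)// mulrA divff// mul1r.
Qed.
End bin.

(** * The exceptional set is null *)

Section exceptional.
Context {R : realType} {m n : nat} {D : set 'rV[R]_n}.
Hypotheses (n_gt0 : (0 < n)%N) (m_gt0 : (0 < m)%N).
Variable f : D -> 'rV[R]_m.

(** Sup norms and integer powers avoid roots until the end; changing to Euclidean norms only affects
    the constant. *)
Definition expands (C : R) (x y : D) :=
  C * `|val x - val y| ^+ n < `|f x - f y| ^+ m.

Definition exceptional : set D :=
  [set x | forall C, exists2 d, 0 < d &
     forall y, y <> x -> `|val x - val y| < d -> expands C x y].

(* For t = (j, p, q): the expansion with constant 1 holds up to distance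
   1 / (j + 1) around x, which lies in the cell p of the grid of mesh
   1 / (j + 1), while f x lies in the unit cell q. *)
Definition piece (t : nat * {ffun 'I_n -> int} * {ffun 'I_m -> int}) : set D :=
  [set x | [/\ exceptional x,
    forall y, y <> x -> `|val x - val y| <= t.1.1.+1%:R^-1 -> expands 1 x y,
    forall i, Num.floor (t.1.1.+1%:R * val x ord0 i) = t.1.2 i &
    forall i, Num.floor (f x ord0 i) = t.2 i]].

Lemma exceptional_pieces : exceptional = \bigcup_t piece t.
Proof.
apply/seteqP; split => [x ex|x [t _ []]//].
have [d d0 dx] := ex 1.
have [j jd] : exists j : nat, j.+1%:R^-1 < d.
  exists (Num.trunc d^-1).
  by rewrite invf_plt ?posrE// truncnS_gt.
exists (j, [ffun i => Num.floor (j.+1%:R * val x ord0 i)],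
  [ffun i => Num.floor (f x ord0 i)]) => //; split => //= [y yx yj|i|i].
- by apply: dx => //; exact: le_lt_trans yj jd.
- by rewrite ffunE.
- by rewrite ffunE.
Qed.

Lemma floor_eq_dist (a b : R) : Num.floor a = Num.floor b -> `|a - b| <= 1.
Proof.
move=> ab; have := floor_le a; have := floor_le b.
have := floorD1_gt a; have := floorD1_gt b.
by rewrite ab !intrD ler_norml; lra.
Qed.

Lemma piece_null t : lebesgue_outer (val @` piece t) = 0%E.
Proof.
case: t => [[j p] q].
pose code l (x : D) := bin l (fun i => f x ord0 i - (q i)%:~R).
(* Sharing a grid cell puts any two points of the piece within the range of expansion with constant
   1. *)
have small x y : piece (j, p, q) x -> piece (j, p, q) y ->
    `|val x - val y| <= j.+1%:R^-1.
  move=> [_ _ /= px _] [_ _ /= py _]; apply: rV_norm_le => // i.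
  rewrite -(@ler_pM2l _ j.+1%:R)// divff// -[X in X * _]ger0_norm// -normrM.
  rewrite !mxE mulrBr.
  by apply: floor_eq_dist; rewrite px py.
have bound C : 0 < C ->
    (lebesgue_outer (val @` piece (j, p, q)) <= (2 ^+ n / C)%:E)%E.
  move=> C0; apply: (lebesgue_outer_coded_le n_gt0 _ D val code) => //.
  - by move=> l x; rewrite size_bin.
  - by move=> k l x; exact: take_bin.
  move=> x px; have [ex x1 _ qx] := px; have [d d0 dx] := ex C.
  have [l ld] : exists l, 2 ^- l < d ^+ n :> R.
    exists (Num.trunc (d ^+ n)^-1).+1.
    rewrite invf_plt ?posrE ?exprn_gt0//.
    apply: lt_trans (truncnS_gt _) _.
    by rewrite -natrX ltr_nat ltn_expl.
  exists l => y py yx.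
  have {yx}fxy : `|f x - f y| <= 2 ^- l.
    apply: rV_norm_le => [|i]; first by rewrite invr_ge0 exprn_ge0.
    have q01 z k : piece (j, p, q) z -> 0 <= f z ord0 k - (q k)%:~R <= 1.
      move=> [_ _ _ /= /(_ k) <-]; have := floor_le (f z ord0 k).
      have := floorD1_gt (f z ord0 k).
      by rewrite intrD; lra.
    have := bin_eq_dist l _ _ (fun k => q01 y k py) (fun k => q01 x k px) yx i.
    by rewrite distrC !mxE opprB addrA subrK.
  have {}fxy : `|f x - f y| ^+ m <= 2 ^- l ^+ m.
    by rewrite lerXn2r ?nnegrE ?invr_ge0 ?exprn_ge0.
  (* There are [2 ^ m] letters, so the weight of a word of length [l] is the volume of a dyadic cube
     of side [2 ^- l]. *)
  rewrite card_ffun card_bool card_ord natrX -exprM.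
  have [->|yx] := pselect (y = x).
    by rewrite subrr normr0 expr0n gtn_eqF// mulr0 invr_ge0 exprn_ge0.
  rewrite mulnC exprM -exprVn; apply: ltW; apply: (lt_le_trans _ fxy).
  apply: dx => //; rewrite -(@ltr_pXn2r _ n) ?nnegrE ?(ltW d0)//.
  (* Constant 1 gives |x - y|^n < 2^(-lm) <= 2^(-l) < d^n, which brings [y] within reach of constant
     [C]. *)
  have := x1 y yx (small _ _ px py); rewrite /expands mul1r.
  move=> /lt_le_trans; apply.
  apply: le_trans fxy _; apply: le_trans (ltW ld).
  rewrite -[leRHS]expr1; apply: ler_wiXn2l => //.
  by rewrite invf_le1 ?exprn_gt0// exprn_ege1// ler1n.
apply/eqP; rewrite eq_le lebesgue_outer_ge0 andbT.
apply/lee_addgt0Pr => e e0; rewrite add0e.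
apply: le_trans (bound (2 ^+ n / e) _) _; first by rewrite divr_gt0 ?exprn_gt0.
by rewrite lee_fin invfM invrK mulrA divff ?mul1r// expf_neq0.
Qed.

Lemma exceptional_null : lebesgue_outer (val @` exceptional) = 0%E.
Proof.
rewrite exceptional_pieces image_bigcup lebesgue_outer_bigcup0//.
exact: piece_null.
Qed.

End exceptional.

(** * Euclidean against sup norm, and the theorem *)

Lemma enorm_ge0 (R : realType) (k : nat) (x : 'rV[R]_k) : 0 <= enorm x.
Proof. exact: sqrtr_ge0. Qed.

Lemma norm_le_enorm (R : realType) (k : nat) (x : 'rV[R]_k) : `|x| <= enorm x.
Proof.
apply: rV_norm_le => [|i]; first exact: enorm_ge0.
rewrite -sqrtr_sqr ler_wsqrtr// (bigD1 i)//= lerDl sumr_ge0// => j _.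
exact: sqr_ge0.
Qed.

Lemma enorm_le_norm (R : realType) (k : nat) (x : 'rV[R]_k) :
  enorm x <= Num.sqrt k%:R * `|x|.
Proof.
rewrite -[X in _ * X]ger0_norm// -sqrtr_sqr -sqrtrM// ler_wsqrtr//.
rewrite mulr_natl -[k in _ *+ k]card_ord -sumr_const ler_sum// => i _.
by rewrite -[leLHS]real_normK ?num_real// lerXn2r ?nnegrE// rV_coord_le.
Qed.

Theorem theorem1 (R : realType) (m n : nat) (hn : (1 <= n)%N) (hnm : (n <= m)%N)
    (D : set 'rV[R]_n) (f : D -> 'rV[R]_m) :
  let alpha : R := n%:R / m%:R in
  exists N : set 'rV[R]_n,
    [/\ N `<=` D, lebesgue_outer N = 0%E &
      forall x : D, ~ N (val x) ->
        exists x_ : nat -> D,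
          [/\ forall k, x_ k <> x,
              (val \o x_) @ \oo --> (val x : 'rV[R]_n) &
              (limn_esup (fun k =>
                 (enorm (f x - f (x_ k))
                    / enorm (val x - val (x_ k)) `^ alpha)%:E) < +oo)%E]].
Proof.
move=> alpha.
have m_gt0 : (0 < m)%N by exact: leq_trans hnm.
exists (val @` exceptional f); split.
- by move=> _ [x _ <-]; exact: set_valP.
- exact: exceptional_null.
move=> x Nx.
have {Nx} : ~ exceptional f x by move=> ex; apply: Nx; exists x.
move=> /existsNP[C xC].
have /choice[x_ x_P] : forall k : nat, exists y : D, [/\ y <> x,
    `|val x - val y| < k.+1%:R^-1 & ~ expands f C x y].
  move=> k; apply: contrapT => no; apply: xC; exists k.+1%:R^-1 => // y yx yk.
  by apply: contrapT => nexp; apply: no; exists y.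
exists x_; split.
- by move=> k; have [] := x_P k.
- apply/cvgrPdist_lt => e e0.
  have := @cvg_harmonic R => /cvgrPdist_lt /(_ e e0).
  apply: filterS => k /=; rewrite sub0r normrN ger0_norm//.
  by apply: lt_trans; have [] := x_P k.
(* [C] may be negative, and an [m]-th root of the constant is taken below. *)
pose C' : R := Num.max C 0.
apply: (@le_lt_trans _ _ (Num.sqrt m%:R * C' `^ m%:R^-1)%:E); last exact: ltry.
apply: (@le_trans _ _ (ereal_sup (range (fun k =>
  (enorm (f x - f (x_ k)) / enorm (val x - val (x_ k)) `^ alpha)%:E)))).
  (* The upper limit is an infimum of suprema over tails, one of which is the whole sequence. *)
  by apply: ereal_inf_lbound; exists setT => //; exact: filterT.
apply: ge_ereal_sup => _ [k _ <-]; rewrite lee_fin.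
have [neq _ /negP] := x_P k; rewrite -leNgt => fC.
have x0 : 0 < `|val x - val (x_ k)|.
  by rewrite normr_gt0 subr_eq0; apply/eqP => /val_inj /esym.
have e0 := lt_le_trans x0 (norm_le_enorm _ _ _).
rewrite ler_pdivrMr ?powR_gt0// -mulrA.
apply: le_trans (enorm_le_norm _ _ _) _.
rewrite ler_wpM2l// /alpha.
have C'0 : 0 <= C' by rewrite le_max lexx orbT.
rewrite powRrM powR_mulrn ?enorm_ge0// -powRM ?exprn_ge0 ?enorm_ge0//.
rewrite -(@ler_pXn2r _ m) ?nnegrE ?powR_ge0//.
rewrite -[leRHS]powR_mulrn ?powR_ge0// -powRrM mulVf ?pnatr_eq0 -?lt0n//.
rewrite powRr1 ?mulr_ge0 ?exprn_ge0 ?enorm_ge0//.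
apply: le_trans fC _; apply: (@le_trans _ _ (C' * `|val x - val (x_ k)| ^+ n)).
  by rewrite ler_wpM2r ?exprn_ge0// le_max lexx.
by rewrite ler_wpM2l// lerXn2r ?nnegrE ?enorm_ge0// norm_le_enorm.
Qed.
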